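(* Fix $\beta\in(0,1)$ and assume that $p=p(N)\in(0,1]$ is such that $p^3N^2\to\infty$ as $N\to\infty$. For every non-negative bounded continuous function $g:\mathbb R\to\mathbb R$ with $g\not\equiv0$, we have $$\lim_{N\to\infty}\frac{\mathbb V(Z_N(\beta,g))}{(\mathbb E Z_N(\beta,g))^2}=0.$$
   Context: For each $N\in\mathbb N$ let $p=p(N)\in(0,1]$ and let $(\varepsilon_{i,j})_{i,j=1}^N$ be independent random variables on a probability space with probability measure $\mathbb P$, with $\mathbb P[\varepsilon_{i,j}=1]=p$ and $\mathbb P[\varepsilon_{i,j}=0]=1-p$ (indicators of the directed edges, loops allowed, of a directed Erdős–Rényi random graph on $\{1,\dots,N\}$). $\mathbb E$ and $\mathbb V$ denote expectation and variance with respect to $\mathbb P$, i.e. with respect to the randomness of $(\varepsilon_{i,j})$. The Hamiltonian is, for $\sigma\in\{-1,+1\}^N$, $$H(\sigma)=H_N(\sigma)=-\frac1{2Np}\sum_{i,j=1}^N\varepsilon_{i,j}\sigma_i\sigma_j.$$ For a bounded continuous function $g:\mathbb R\to\mathbb R$ the generalized partition function is $$Z_N(\beta,g)=\sum_{\sigma\in\{-1,+1\}^N}e^{-\beta H(\sigma)}\,g\left(\frac{\sum_{i=1}^N\sigma_i}{\sqrt N}\right).$$ *)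

(* Defs.v *)
From mathcomp Require Import all_boot all_order all_algebra.
From mathcomp Require Import all_classical all_reals all_analysis.

Set Implicit Arguments.
Unset Strict Implicit.
Unset Printing Implicit Defensive.

Import Order.TTheory GRing.Theory Num.Theory.
Import numFieldNormedType.Exports.

Local Open Scope classical_set_scope.
Local Open Scope ring_scope.

Definition mutually_independent (R : realType) (d : measure_display)
    (T : measurableType d) (P : probability T R) (I : finType)
    (X : I -> {RV P >-> R}) : Prop :=
  forall (J : {set I}) (B : I -> set R), (forall i, measurable (B i)) ->
    P (\bigcap_(i in [set` J]) (X i @^-1` B i)) =
    (\prod_(i in J) P (X i @^-1` B i))%E.

(* The spins are encoded by Booleans: [false] stands for +1, [true] for -1. *)
Definition config (N : nat) : finType := {ffun 'I_N -> bool}.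

Definition spin (R : realType) (N : nat) (s : config N) (i : 'I_N) : R :=
  (-1) ^+ s i.

Definition hamiltonian (R : realType) (N : nat) (p : R)
    (e : 'I_N * 'I_N -> R) (s : config N) : R :=
  - (2 * N%:R * p)^-1 *
    \sum_(i < N) \sum_(j < N) e (i, j) * spin R s i * spin R s j.

Definition partition_function (R : realType) (N : nat) (p beta : R)
    (g : R -> R) (e : 'I_N * 'I_N -> R) : R :=
  \sum_(s : config N)
    expR (- beta * hamiltonian p e s) *
    g ((\sum_(i < N) spin R s i) / Num.sqrt N%:R).

(* Main.v *)
(* Write S, S' for the magnetizations of two configurations and Q for their
   overlap.  Averaging over the edges gives, with m(y) = 1 - p + p e^y and
   x = beta / (2 N p),
     E Z   = sum_s g exp(u N^2 + v S^2),
     E Z^2 = sum_{s, s'} g g' exp((U (N^2 + Q^2) + V (S^2 + S'^2)) / 2),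
   where u, v are the even and odd parts of ln m at x, and U, V those at 2 x.
   Expanding, N^2 (U / 2 - 2 u) = O(1 / (p^3 N^2)), while N U and N (V / 2 - v)
   are O(1 / (N p)); this is where p^3 N^2 -> oo enters.  Hence E Z^2 and
   (E Z)^2 differ, up to the factor e^(2 u N^2), by a vanishing multiple of
   sum_{s, s'} exp(theta Q^2 / N + (beta / 2 + theta) (S^2 + S'^2) / N), which
   is O(4^N) because beta < 1 and Rademacher sums are subgaussian.  Finally
   sum_s g >= const * 2^N, by an elementary lower bound on the binomial weights
   at distance O(sqrt N) from the center. *)

Require Import Defs.
From mathcomp Require Import all_boot all_order all_algebra.
From mathcomp Require Import all_classical all_reals all_analysis.
From mathcomp Require Import measurable_realfun.
From mathcomp Require Import ring lra zify.

Set Implicit Arguments.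
Unset Strict Implicit.
Unset Printing Implicit Defensive.

Import Order.TTheory GRing.Theory Num.Theory.
Import numFieldNormedType.Exports.

Local Open Scope classical_set_scope.
Local Open Scope ring_scope.

(** * Subgaussian moments of the magnetization *)

Lemma series_exp_coeff_le_expR (R : realType) (y : R) (n : nat) :
  0 <= y -> series (exp_coeff y) n <= expR y.
Proof.
move=> y0; apply: nondecreasing_cvgn_le; last exact: is_cvg_series_exp_coeff.
by apply: nondecreasing_series => k _ _; rewrite /exp_coeff divr_ge0 ?exprn_ge0.
Qed.

(* Termwise comparison of power series, as [(2n)! >= 2^n n!]. *)
Lemma cosh_le_expR_sqr (R : realType) (x : R) :
  expR x + expR (- x) <= 2 * expR (x ^+ 2 / 2).
Proof.
have fact2 n : (2 ^ n * n`! <= n.*2`!)%N.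
  elim: n => // n IH; rewrite doubleS !factS expnS.
  apply: (@leq_trans (2 * n.+1 * n.*2`!)).
    by rewrite -!mulnA leq_mul2l /= mulnCA leq_mul2l /= IH.
  by rewrite mulnA leq_mul2r; apply/orP; right; rewrite -doubleS -mul2n leq_pmulr.
pose b k : R := exp_coeff x k + exp_coeff (- x) k.
have bE k : b k.*2 = 2 * ((x ^+ 2) ^+ k / k.*2`!%:R).
  by rewrite /b /exp_coeff /= -!muln2 mulnC !exprM sqrrN; ring.
have b0 k : b k.*2.+1 = 0.
  by rewrite /b /exp_coeff /= exprNn -signr_odd /= odd_double expr1 mulN1r mulNr subrr.
have bge0 k : 0 <= b k.
  rewrite -(odd_double_half k); case: (odd k); first by rewrite add1n b0.
  rewrite add0n bE.
  by rewrite !mulr_ge0 ?invr_ge0 // exprn_ge0 // sqr_ge0.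
have ble k : b k.*2 <= 2 * exp_coeff (x ^+ 2 / 2) k.
  rewrite bE /exp_coeff /= ler_pM2l // expr_div_n -mulrA.
  rewrite ler_wpM2l //; first by rewrite exprn_ge0 // sqr_ge0.
  rewrite -invfM lef_pV2 ?posrE ?ltr0n ?fact_gt0 //.
  by rewrite -natrX -natrM ler_nat.
have sle n : \sum_(0 <= k < n.*2) b k <= 2 * series (exp_coeff (x ^+ 2 / 2)) n.
  elim: n => [|n IH]; first by rewrite big_geq // /series /= big_geq // mulr0.
  rewrite doubleS !big_nat_recr //= b0 addr0 /series /= big_nat_recr //= mulrDr.
  exact: lerD.
have cv y : series (exp_coeff y) n @[n --> \oo] --> expR y.
  exact: is_cvg_series_exp_coeff.
have cvb : (series (exp_coeff x) n + series (exp_coeff (- x)) n) @[n --> \oo]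
    --> expR x + expR (- x).
  by apply: cvgD; exact: cv.
rewrite -(cvg_lim _ cvb) //; apply: limr_le; first by apply/cvg_ex; eexists; exact: cvb.
near=> n; rewrite /series /= -big_split /=.
(* Since all [b k] are nonnegative, passing from [n] to [2 n] terms can only increase the sum, which
   then matches [sle]. *)
apply: le_trans (_ : \sum_(0 <= k < n.*2) b k <= _).
  rewrite [leRHS](@big_cat_nat _ _ _ n) //= -?addnn ?leq_addr // lerDl.
  by apply: sumr_ge0.
apply: le_trans (sle n) _; rewrite ler_pM2l //.
by apply: series_exp_coeff_le_expR; rewrite divr_ge0 ?sqr_ge0.
Unshelve. all: by end_near. Qed.

Lemma sum_config_prod (R : realType) (N : nat) (f : 'I_N -> bool -> R) :
  \sum_(s : config N) \prod_(i < N) f i (s i) = \prod_(i < N) (f i true + f i false).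
Proof.
under [RHS]eq_bigr do rewrite -big_bool.
by rewrite bigA_distr_bigA.
Qed.

Definition mag (R : realType) (N : nat) (s : config N) : R := \sum_(i < N) spin R s i.

Lemma sum_expR_mag (R : realType) (N : nat) (l : R) :
  \sum_(s : config N) expR (l * mag R s) = (expR l + expR (- l)) ^+ N.
Proof.
under eq_bigr do rewrite /mag mulr_sumr expR_sum.
rewrite (sum_config_prod (fun=> fun b : bool => expR (l * (-1) ^+ b))).
by rewrite prodr_const card_ord expr1 expr0 mulrN mulr1 addrC.
Qed.

Lemma sum_expR_mag_le (R : realType) (N : nat) (l : R) :
  \sum_(s : config N) expR (l * mag R s) <= 2 ^+ N * expR (N%:R * (l ^+ 2 / 2)).
Proof.
rewrite sum_expR_mag expRM_natl -exprMn lerXn2r ?nnegrE ?addr_ge0 ?mulr_ge0 ?expR_ge0 //.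
exact: cosh_le_expR_sqr.
Qed.

Lemma normr_mag_le (R : realType) (N : nat) (s : config N) : `|mag R s| <= N%:R.
Proof.
apply: le_trans (ler_norm_sum _ _ _) _.
by rewrite (eq_bigr (fun=> 1)) ?sumr_const ?card_ord // => i _; rewrite normr_sign.
Qed.

(* At [k = trunc |y|] the term of index [k] already dominates, by completing the square. *)
Lemma expR_sqr_le_sum (R : realType) (c y : R) (n : nat) :
  0 < c -> `|y| < n%:R ->
  expR ((1 / 2 - c) * y ^+ 2) <=
  expR (1 / 2) * \sum_(k < n) (expR (k%:R * y) + expR (- k%:R * y)) *
    expR (- (1 / 2 + c) * k%:R ^+ 2).
Proof.
move=> c0 yn; set k := Num.trunc `|y|.
have kn : (k < n)%N by rewrite truncn_lt_nat.
have /andP[ky yk] : k%:R <= `|y| < k.+1%:R by apply: truncn_itv.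
rewrite (bigD1 (Ordinal kn)) //= mulrDr.
apply: ler_wpDr.
  by rewrite mulr_ge0 ?expR_ge0 // sumr_ge0.
have : expR (k%:R * `|y|) <= expR (k%:R * y) + expR (- k%:R * y).
  by case: (ger0P y) => _; rewrite ?mulrN ?mulNr ?lerDl ?lerDr expR_ge0.
move=> /(ler_wpM2r (expR_ge0 (- (1 / 2 + c) * k%:R ^+ 2))).
move=> /(ler_wpM2l (expR_ge0 (1 / 2))); apply: le_trans.
rewrite -!expRD ler_expR -(real_normK (num_real y)).
have k0 : 0 <= k%:R :> R by [].
rewrite -natr1 in yk.
(* As [|y| - k] lies in [[0, 1)], its square is at most 1, so [y^2 / 2 <= 1 / 2 + k |y| - k^2 / 2];
   [h2] handles the remaining [- c y^2 <= - c k^2]. *)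
have h1 : 0 <= (1 - (`|y| - k%:R)) * (1 + (`|y| - k%:R)).
  by apply: mulr_ge0; lra.
have h2 : 0 <= c * ((`|y| - k%:R) * (`|y| + k%:R)).
  by rewrite !mulr_ge0 ?(ltW c0) //; lra.
lra.
Qed.

(** A discrete form of Gaussian linearization: [expR_sqr_le_sum] replaces the square by integer
    linear tilts, the tilt [k] costs at most [2^N e^(k^2 / 2)], and the weights leave a geometric
    series in [e^(-c)]. The constant does not depend on [N]. *)
Lemma sum_expR_mag_sqr_le (R : realType) (N : nat) (c : R) :
  (0 < N)%N -> 0 < c ->
  \sum_(s : config N) expR ((1 / 2 - c) * (mag R s ^+ 2 / N%:R)) <=
  2 ^+ N * (2 * expR (1 / 2) / (1 - expR (- c))).
Proof.
move=> N0 c0.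
have sN0 : 0 < Num.sqrt N%:R :> R by rewrite sqrtr_gt0 ltr0n.
have NE : N%:R = Num.sqrt N%:R ^+ 2 :> R by rewrite sqr_sqrtr.
pose y (s : config N) : R := mag R s / Num.sqrt N%:R.
have yE s : mag R s ^+ 2 / N%:R = y s ^+ 2 by rewrite /y expr_div_n -NE.
have yN s : `|y s| < N.+1%:R.
  apply: (@le_lt_trans _ _ N%:R); last by rewrite ltr_nat.
  rewrite /y normrM normfV (gtr0_norm sN0) ler_pdivrMr //.
  apply: le_trans (normr_mag_le _ _) _; rewrite ler_peMr //.
  by rewrite -[leLHS]sqrtr1 ler_wsqrtr // ler1n.
apply: (@le_trans _ _ (\sum_(s : config N) expR (1 / 2) * \sum_(k < N.+1)
    (expR (k%:R * y s) + expR (- k%:R * y s)) * expR (- (1 / 2 + c) * k%:R ^+ 2))).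
  by apply: ler_sum => s _; rewrite yE; exact: expR_sqr_le_sum.
rewrite -mulr_sumr exchange_big /=.
have tiltE (k : R) : \sum_(s : config N) expR (k * y s) <= 2 ^+ N * expR (k ^+ 2 / 2).
  have -> : k ^+ 2 / 2 = N%:R * ((k / Num.sqrt N%:R) ^+ 2 / 2).
    by rewrite expr_div_n -NE; field; rewrite pnatr_eq0 -lt0n.
  apply: le_trans (sum_expR_mag_le _ _); rewrite le_eqVlt; apply/orP; left.
  by apply/eqP/eq_bigr => s _; congr expR; rewrite /y; ring.
apply: (@le_trans _ _ (expR (1 / 2) *
    \sum_(k < N.+1) 2 ^+ N * (2 * expR (- c) ^+ k))).
  rewrite ler_wpM2l ?expR_ge0 //; apply: ler_sum => k _.
  rewrite -mulr_suml big_split /=.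
  apply: (@le_trans _ _ ((2 ^+ N * (2 * expR (k%:R ^+ 2 / 2))) *
      expR (- (1 / 2 + c) * k%:R ^+ 2))).
    rewrite ler_wpM2r ?expR_ge0 // mulrCA mulr_natl mulr2n lerD ?tiltE //.
    by apply: le_trans (tiltE _) _; rewrite sqrrN.
  rewrite -!mulrA -expRD !ler_pM2l ?exprn_gt0 // -expRM_natl ler_expR.
  (* The remaining factor [e^(-c k^2)] is weakened to [e^(-c k)] to make the series geometric. *)
  have : (k : nat)%:R <= (k : nat)%:R ^+ 2 :> R.
    by rewrite -natrX ler_nat; case: (k : nat) => [|j] //; rewrite -[leqLHS]expn1 leq_pexp2l.
  nra.
rewrite -mulr_sumr mulrCA ler_pM2l ?exprn_gt0 //.
rewrite -mulr_sumr mulrCA -!mulrA ler_pM2l // ler_pM2l ?expR_gt0 //.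
have e1 : expR (- c) < 1 by rewrite expR_lt1 oppr_lt0.
have := @geometric_le_lim R N.+1 1 (expR (- c)) ler01 (expR_gt0 _).
rewrite gtr0_norm ?expR_gt0 // e1 => /(_ isT).
rewrite /series /= big_mkord.
rewrite div1r; apply: le_trans.
by rewrite le_eqVlt; apply/orP; left; apply/eqP/eq_bigr => k _; rewrite mul1r.
Qed.

(* [(s, t) |-> (s, s t)] is a bijection of pairs of configurations. *)
Lemma sum_overlap (R : realType) (N : nat) (f : R -> R) :
  \sum_(s : config N) \sum_(t : config N) f (\sum_(i < N) spin R s i * spin R t i) =
  2 ^+ N * \sum_(s : config N) f (mag R s).
Proof.
transitivity (\sum_(s : config N) \sum_(t : config N) f (mag R t)).
  apply: eq_bigr => s _.
  pose h (t : config N) : config N := [ffun i => s i (+) t i].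
  have hK : involutive h by move=> t; apply/ffunP => i; rewrite !ffunE addKb.
  rewrite (reindex_inj (inv_inj hK)) /=; apply: eq_bigr => t _; congr f.
  apply: eq_bigr => i _; rewrite /spin ffunE signr_addb mulrA -expr2 sqrr_sign.
  by rewrite mul1r.
by rewrite sumr_const card_ffun card_bool card_ord -[LHS]mulr_natl natrX.
Qed.

(** Either [a <= t b] or [b < a / t], so one of the two exponents dominates [a + b]. This separates
    the overlap from the magnetizations. *)
Lemma expRD_le (R : realType) (a b t : R) : 0 < t ->
  expR (a + b) <= expR ((1 + t) * b) + expR ((1 + t^-1) * a).
Proof.
move=> t0; case: (lerP a (t * b)) => ab.
  by apply: ler_wpDr; rewrite ?expR_ge0 // ler_expR mulrDl mul1r addrC lerD2l.
apply: ler_wpDl; rewrite ?expR_ge0 // ler_expR mulrDl mul1r lerD2l.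
by rewrite mulrC ler_pdivlMr // mulrC ltW.
Qed.

(** After [expRD_le], the magnetization term factorizes into two single sums, giving [K^2], and the
    overlap term reduces to one sum by [sum_overlap], giving [K]. A small [t] is affordable for [b]
    near [1 / 2] provided [a] is small enough to absorb [1 + t^-1]. *)
Lemma sum_pair_expR_le (R : realType) (N : nat) (a b c t K : R) :
  (0 < N)%N -> 0 < c -> 0 < t ->
  (1 + t) * b <= 1 / 2 - c -> (1 + t^-1) * a <= 1 / 2 - c ->
  K = 2 * expR (1 / 2) / (1 - expR (- c)) ->
  \sum_(s : config N) \sum_(s' : config N)
    expR (a * ((\sum_(i < N) spin R s i * spin R s' i) ^+ 2 / N%:R) +
          b * (mag R s ^+ 2 / N%:R + mag R s' ^+ 2 / N%:R)) <=
  (2 ^+ N) ^+ 2 * (K ^+ 2 + K).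
Proof.
move=> N0 c0 t0 bc ac KE; set Y := fun s : config N => mag R s ^+ 2 / N%:R.
have NN x : 0 <= x ^+ 2 / N%:R :> R by rewrite divr_ge0 ?sqr_ge0.
have KP : \sum_(s : config N) expR ((1 / 2 - c) * Y s) <= 2 ^+ N * K.
  by rewrite KE; exact: sum_expR_mag_sqr_le.
set Q := fun s s' : config N => (\sum_(i < N) spin R s i * spin R s' i) ^+ 2 / N%:R.
apply: (@le_trans _ _ (\sum_(s : config N) \sum_(s' : config N)
   (expR ((1 / 2 - c) * Y s) * expR ((1 / 2 - c) * Y s') +
    expR ((1 / 2 - c) * Q s s')))).
  apply: ler_sum => s _; apply: ler_sum => s' _.
  apply: le_trans (expRD_le _ _ t0) _; rewrite -expRD -mulrDr; apply: lerD.
    by rewrite ler_expR [leLHS]mulrA; apply: ler_wpM2r => //; rewrite addr_ge0 ?NN.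
  by rewrite ler_expR [leLHS]mulrA; apply: ler_wpM2r; rewrite ?NN.
under eq_bigr do rewrite big_split /= -mulr_sumr.
rewrite big_split /= -mulr_suml -expr2 mulrDr; apply: lerD.
  by rewrite -exprMn lerXn2r ?nnegrE ?(le_trans _ KP) // sumr_ge0 // => s _; rewrite expR_ge0.
rewrite /Q (sum_overlap N (fun x => expR ((1 / 2 - c) * (x ^+ 2 / N%:R)))).
by rewrite expr2 -mulrA ler_wpM2l ?exprn_ge0.
Qed.

(** * Binomial lower bounds *)

(** Induction on [m = n + 1]: the central coefficient is multiplied by [2 (2 m + 1) / (m + 1)], and
    the step closes because [4 m (m + 1) <= (2 m + 1)^2]. *)
Lemma central_binomial_even (n : nat) :
  (4 ^ n.+1.*2 <= 4 * n.+1 * 'C(n.+1.*2, n.+1) ^ 2)%N.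
Proof.
elim: n => [|n IH] //; move: IH; move: n.+1 => m IH.
have e1 : ('C(m.+1.*2, m.+1) = 2 * 'C(m.*2.+1, m.+1))%N.
  rewrite doubleS binS mul2n -[RHS]addnn; congr addn.
  by rewrite (_ : m.+1 = (m.*2.+1 - m)%N) ?bin_sub //; lia.
have e2 : (m.+1 * 'C(m.*2.+1, m.+1) = m.*2.+1 * 'C(m.*2, m))%N.
  by rewrite -mul_bin_diag.
rewrite e1 -(@leq_pmul2l (m.+1 ^ 2)) ?expn_gt0 //.
have -> : (m.+1 ^ 2 * (4 * m.+1 * (2 * 'C(m.*2.+1, m.+1)) ^ 2) =
   16 * m.+1 * (m.+1 * 'C(m.*2.+1, m.+1)) ^ 2)%N by lia.
rewrite e2 doubleS (_ : (4 ^ m.*2.+2 = 16 * 4 ^ m.*2)%N); last by rewrite !expnS mulnA.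
move: IH; set x := (4 ^ m.*2)%N; set y := 'C(_, _); rewrite -!mulnn -muln2 => IH.
have : (m.+1 * (m.+1 * x) <= m.+1 * (m.+1 * (4 * m * (y * y))))%N by rewrite !leq_mul.
nia.
Qed.

Lemma central_binomial_ge (n : nat) : (4 ^ n <= (2 * n + 2) * 'C(n, n./2) ^ 2)%N.
Proof.
case: n => // n; rewrite -(odd_double_half n); move: n./2 => h.
case: (odd n); rewrite ?add1n ?add0n.
  rewrite -doubleS doubleK; apply: leq_trans (central_binomial_even _) _.
  by rewrite leq_mul2r; apply/orP; right; lia.
rewrite (_ : h.*2.+1./2 = h); last by lia.
(* For odd rows, the middle coefficient is half of the next even central one; this case produces
   exactly the factor [2 n + 2]. *)
have e1 : ('C(h.+1.*2, h.+1) = 2 * 'C(h.*2.+1, h))%N.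
  rewrite doubleS binS mul2n -[RHS]addnn; congr addn.
  by rewrite (_ : h.+1 = (h.*2.+1 - h)%N) ?bin_sub //; lia.
have := central_binomial_even h; rewrite e1 doubleS expnS -!mulnn.
set x := (4 ^ _)%N; set y := 'C(_, _); nia.
Qed.

Lemma central_binomial_ge_sqrt (R : realType) (n : nat) : (0 < n)%N ->
  2 ^+ n / (2 * Num.sqrt n%:R) <= 'C(n, n./2)%:R :> R.
Proof.
move=> n0; have s0 : 0 < Num.sqrt n%:R :> R by rewrite sqrtr_gt0 ltr0n.
rewrite ler_pdivrMr ?mulr_gt0 // -(@ler_pXn2r _ 2) ?nnegrE ?mulr_ge0 ?exprn_ge0 //.
rewrite !exprMn sqr_sqrtr // -exprM mulnC exprM -!natrX -!natrM ler_nat.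
apply: leq_trans (central_binomial_ge n) _.
by rewrite mulnC leq_mul2l; apply/orP; right; lia.
Qed.

(** The ratio of consecutive coefficients is [(n - k - j) / (k + j + 1) >= (k - j) / (k + j + 1)].
    With [z = 2 J / (k - J)] it is at least [e^(-z)], since [(k - j) (1 + z) >= k - j + 2 J >= k + j
    + 1] for [j < J]. *)
Lemma binomial_decay (R : realType) (n k J j : nat) :
  (k.*2 <= n)%N -> (J < k)%N -> (j <= J)%N ->
  'C(n, k)%:R * expR (- (2 * J%:R / (k%:R - J%:R)) * j%:R) <= 'C(n, k + j)%:R :> R.
Proof.
move=> kn Jk; elim: j => [|j IH] jJ; first by rewrite mulr0 expR0 mulr1 addn0.
have {IH} := IH (ltnW jJ).
set z := 2 * J%:R / _; set C := 'C(n, k)%:R => IH.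
have kJ : 0 < k%:R - J%:R :> R by rewrite subr_gt0 ltr_nat.
have kj : 0 < k%:R - j%:R :> R by rewrite subr_gt0 ltr_nat (ltn_trans jJ Jk).
have h1 : (k + j.+1)%:R <= (k%:R - j%:R) * expR z.
  apply: (@le_trans _ _ ((k%:R - j%:R) * (1 + z))); last first.
    by rewrite ler_pM2l // expR_ge1Dx.
  have : 2 * J%:R <= (k%:R - j%:R) * z.
    rewrite /z mulrA ler_pdivlMr // mulrC ler_wpM2r //.
    by rewrite lerB // ler_nat ltnW.
  have : 2 * j%:R + 1 <= 2 * J%:R :> R by rewrite -!natrM natr1 ler_nat; lia.
  rewrite natrD -natr1; lra.
have h2 : (k%:R - j%:R) * 'C(n, k + j)%:R <= (k + j.+1)%:R * 'C(n, k + j.+1)%:R :> R.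
  rewrite addnS -[leRHS]natrM mul_bin_left -natrB; last by lia.
  by rewrite -natrM ler_nat leq_mul2r; apply/orP; right; lia.
rewrite -(@ler_pM2l _ ((k%:R - j%:R) * expR z)) ?mulr_gt0 ?expR_gt0 //.
apply: (@le_trans _ _ ((k + j.+1)%:R * 'C(n, k + j.+1)%:R)); last first.
  by rewrite ler_wpM2r.
apply: le_trans h2; rewrite -mulrA ler_pM2l // mulrCA -expRD.
rewrite (_ : z + - z * j.+1%:R = - z * j%:R) // -natr1; ring.
Qed.

(** The window contains of order [sqrt n] indices, each with a coefficient of order at least
    [2^n / sqrt n]. *)
Lemma binomial_window (R : realType) (a b : R) : 0 <= a < b ->
  exists c r0 : R, 0 < c /\ forall n : nat, r0 <= Num.sqrt n%:R ->
  c * 2 ^+ n <= \sum_(0 <= k < n.+1 |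
     a < (2 * k%:R - n%:R) / Num.sqrt n%:R < b) 'C(n, k)%:R.
Proof.
move=> /andP[a0 ab]; have b0 : 0 < b by apply: le_lt_trans ab.
(* The factor [(b - a) / 16] is the index count [(b - a) r / 8] times [1 / (2 r)] from the central
   coefficient. The threshold ensures [(b - a) r >= 8] and [r >= 2 b + 2]. *)
exists ((b - a) / 16 * expR (- (2 * b ^+ 2))), (1 + 8 / (b - a) + (2 * b + 2)).
split; first by rewrite mulr_gt0 ?expR_gt0 // divr_gt0 // subr_gt0.
move=> n; set r := Num.sqrt _ => r_ge.
have d0 : 0 < b - a by rewrite subr_gt0.
have dV0 : 0 < 8 / (b - a) by rewrite divr_gt0.
have r0 : 0 < r by lra.
have n0 : (0 < n)%N by rewrite -(ltr_nat R) -sqrtr_gt0.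
have rr : n%:R = r ^+ 2 :> R by rewrite sqr_sqrtr.
have dr : 8 <= (b - a) * r.
  by rewrite mulrC -ler_pdivrMr //; lra.
(* The indices used are [k + m, ..., k + m + l - 1]. The shift by 2 in [m] covers the truncation and
   the parity loss [2 k >= n - 1]; taking [l] near [(b - a) r / 4] leaves room for it below [b]. *)
set k := n./2; set m := (Num.trunc (a * r / 2)).+2; set l := Num.trunc ((b - a) * r / 4).
have kn : (k.*2 <= n)%N by rewrite /k; lia.
have nk : (n <= k.*2.+1)%N by rewrite /k; lia.
have kn' : 2 * k%:R <= n%:R :> R by rewrite -natrM ler_nat mul2n.
have nk' : n%:R <= 2 * k%:R + 1 :> R by rewrite -natrM natr1 ler_nat mul2n.
have /andP[m1 m2] : (m%:R - 2 : R) <= a * r / 2 < m%:R - 1.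
  have := @truncn_itv _ (a * r / 2); rewrite divr_ge0 ?mulr_ge0 ?(ltW r0) ?(ltW d0) // => /(_ isT).
  by rewrite -!natr1; lra.
have /andP[l1 l2] : (l%:R : R) <= (b - a) * r / 4 < l%:R + 1.
  have := @truncn_itv _ ((b - a) * r / 4); rewrite divr_ge0 ?mulr_ge0 ?(ltW r0) ?(ltW d0) // => /(_ isT).
  by rewrite -/l -(natr1 l).
have Ck := central_binomial_ge_sqrt R n0; rewrite -/k -/r in Ck.
clearbody k m l.
have Jb : (m + l)%:R <= b * r / 2 :> R by rewrite natrD; lra.
have kJ : r ^+ 2 / 4 <= k%:R - (m + l)%:R.
  have : r * (2 * b + 2) <= r * r by rewrite ler_pM2l //; lra.
  lra.
have Jk : (m + l < k)%N.
  by rewrite -(ltr_nat R) -subr_gt0; apply: lt_le_trans kJ; rewrite divr_gt0 ?exprn_gt0.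
have kml : (k + m + l <= n.+1)%N by clear -Jk kn; lia.
pose F j : R := if a < (2 * j%:R - n%:R) / r < b then 'C(n, j)%:R else 0.
have F0 j : 0 <= F j by rewrite /F; case: ifP.
have FJ j : (k + m <= j < k + m + l)%N ->
    2 ^+ n / (2 * r) * expR (- (2 * b ^+ 2)) <= F j.
  move=> /andP[j1 j2]; have kj := leq_trans (leq_addr m k) j1.
  move: j1 j2; rewrite -(subnKC kj) leq_add2l -addnA ltn_add2l.
  move: (j - k)%N => i {j kj} mi iJ'; have {}mi : m%:R <= i%:R :> R by rewrite ler_nat.
  have iJ : i%:R + 1 <= (m + l)%:R :> R by rewrite natr1 ler_nat.
  have i0 : 0 <= i%:R :> R by [].
  rewrite /F natrD ltr_pdivlMr // ltr_pdivrMr // ifT; last by apply/andP; split; lra.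
  apply: (@le_trans _ _ ('C(n, k)%:R * expR (- (2 * b ^+ 2)))).
    by rewrite ler_pM2r ?expR_gt0 //.
  apply: le_trans (@binomial_decay R n k (m + l) i kn Jk (ltnW iJ')).
  rewrite ler_wpM2l // ler_expR mulNr lerN2 mulrAC ler_pdivrMr; last by nra.
  (* The exponent [2 J i / (k - J)] is at most [2 b^2], because [J i <= J^2 <= b^2 r^2 / 4] and
     [k - J >= r^2 / 4]. *)
  move: kJ iJ Jb; set J := (m + l)%:R => kJ iJ Jb.
  have h1 : J * i%:R <= J * J by rewrite ler_wpM2l //; lra.
  have h2 : J * J <= (b * r / 2) * (b * r / 2) by rewrite ler_pM //; lra.
  have h3 : b ^+ 2 * (r ^+ 2 / 4) <= b ^+ 2 * (k%:R - J) by rewrite ler_wpM2l ?sqr_ge0.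
  lra.
rewrite big_mkcond /=.
apply: (@le_trans _ _ (\sum_(k + m <= j < k + m + l) F j)); last first.
  rewrite (@big_cat_nat _ _ _ (k + m) 0 n.+1) //=; last exact: leq_trans (leq_addr _ _) kml.
  rewrite (@big_cat_nat _ _ _ (k + m + l) (k + m) n.+1) //= ?leq_addr //.
  rewrite addrCA lerDl addr_ge0 // sumr_ge0 // => j _; exact: F0.
apply: (le_trans _ (ler_sum_nat FJ)).
rewrite sumr_const_nat addKn -[leRHS]mulr_natl.
have l0 : (b - a) * r / 8 <= l%:R by lra.
apply: le_trans (ler_wpM2r _ l0); last by rewrite mulr_ge0 ?expR_ge0 // divr_ge0 ?mulr_ge0 ?exprn_ge0 // ltW.
by rewrite le_eqVlt; apply/orP; left; apply/eqP; field; rewrite gt_eqF.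
Qed.

(** A configuration is identified with the set of its negative spins, and these sets are grouped by
    size. *)
Lemma sum_config_card (R : realType) (N : nat) (F : nat -> R) :
  \sum_(s : config N) F #|finset s| = \sum_(0 <= k < N.+1) 'C(N, k)%:R * F k.
Proof.
pose h (A : {set 'I_N}) : config N := [ffun i => i \in A].
pose h' (s : config N) : {set 'I_N} := finset s.
have hK : cancel h h' by move=> A; apply/setP => i; rewrite inE ffunE.
have h'K : cancel h' h by move=> s; apply/ffunP => i; rewrite ffunE inE.
rewrite (reindex h) /=; last by exists h' => ? _; [exact: hK|exact: h'K].
rewrite (eq_bigr (fun A : {set 'I_N} => F #|A|)); last first.
  by move=> A _; rewrite -/(h' _) hK.
rewrite (partition_big (fun A : {set 'I_N} => inord #|A| : 'I_N.+1) predT) //=.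
rewrite big_mkord; apply: eq_bigr => k _.
have AN (A : {set 'I_N}) : (#|A| < N.+1)%N by rewrite ltnS -[N in leqRHS]card_ord max_card.
have AE (A : {set 'I_N}) : (inord #|A| == k :> 'I_N.+1) = (#|A| == k).
  by rewrite -val_eqE /= inordK.
rewrite (eq_bigl _ _ AE) (eq_bigr (fun=> F k)); last by move=> A /eqP ->.
have := card_draws 'I_N k; rewrite card_ord sumr_const mulr_natl => <-.
by congr (_ *+ _); apply: eq_card => A; rewrite !inE.
Qed.

Lemma mag_card (R : realType) (N : nat) (s : config N) :
  mag R s = N%:R - 2 * #|finset s|%:R.
Proof.
have -> : N%:R = \sum_(i < N) 1 :> R by rewrite sumr_const card_ord.
rewrite -sum1_card natr_sum mulr_sumr [X in _ - X]big_mkcond -sumrB; apply: eq_bigr => i _.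
by rewrite /spin inE; case: (s i); rewrite ?expr1 ?expr0; ring.
Qed.

Lemma mag_flip (R : realType) (N : nat) (f : R -> R) :
  \sum_(s : config N) f (mag R s) = \sum_(s : config N) f (- mag R s).
Proof.
pose h (s : config N) : config N := [ffun i => ~~ s i].
have hK : involutive h by move=> t; apply/ffunP => i; rewrite !ffunE negbK.
rewrite (reindex_inj (inv_inj hK)) /=; apply: eq_bigr => s _; congr f.
rewrite /mag -sumrN; apply: eq_bigr => i _; rewrite /spin ffunE.
by rewrite signrN.
Qed.

(* Replaces the central limit theorem: only this lower bound is needed. *)
Lemma mag_window (R : realType) (a b : R) : a < b ->
  exists c r0 : R, 0 < c /\ forall N : nat, r0 <= Num.sqrt N%:R ->
  c * 2 ^+ N <= \sum_(s : config N) (a < mag R s / Num.sqrt N%:R < b)%R%:R.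
Proof.
(* The global spin flip exchanges the windows [(a, b)] and [(-b, -a)]; if [b <= 0], the second has a
   positive right end. *)
wlog b0 : a b / 0 < b => [hw ab|ab].
  case: (ltrP 0 b) => b0; first exact: hw.
  have [||c [r0 [c0 H]]] := hw (- b) (- a); rewrite ?ltrN2 ?oppr_gt0 //.
    by apply: lt_le_trans b0.
  exists c, r0; split => // N Nr.
  rewrite (mag_flip N (fun x => (a < x / Num.sqrt N%:R < b)%R%:R)).
  apply: le_trans (H N Nr) _; rewrite le_eqVlt; apply/orP; left.
  by apply/eqP/eq_bigr => s _; rewrite mulNr ltrNr ltrNl andbC.
(* Only the nonnegative part of the window is kept. Another flip then turns [N - 2 k] into the
   [2 k - N] of the binomial sum. *)
have [|c [r0 [c0 H]]] := @binomial_window R (Num.max a 0) b.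
  by rewrite le_max lexx orbT gt_max ab.
exists c, r0; split => // N Nr; apply: le_trans (H N Nr) _.
rewrite (mag_flip N (fun x => (a < x / Num.sqrt N%:R < b)%R%:R)).
under [leRHS]eq_bigr do rewrite mag_card opprB.
rewrite (sum_config_card N (fun k => (a < (2 * k%:R - N%:R) / Num.sqrt N%:R < b)%R%:R)).
rewrite big_mkcond /=; apply: ler_sum => k _.
rewrite gt_max; case: ifP => [/andP[/andP[-> _] ->]|_]; first by rewrite mulr1.
by rewrite mulr_ge0.
Qed.

(** * Expectations of functions of Bernoulli variables *)

Section bernoulli.
Variables (R : realType) (d : measure_display) (T : measurableType d).
Variables (P : probability T R) (I : finType) (X : I -> {RV P >-> R}) (p : R).
Hypothesis X_indep : mutually_independent X.
Hypothesis X1 : forall i, P (X i @^-1` [set 1]) = p%:E.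
Hypothesis X0 : forall i, P (X i @^-1` [set 0]) = (1 - p)%:E.

Local Notation bern b := (if b then p else 1 - p).

Let mX i (B : set R) : measurable B -> measurable (X i @^-1` B).
Proof. by move=> mB; rewrite -[X in measurable X]setTI; exact: measurable_funPT. Qed.

(** The masses at 0 and 1 add up to 1, so every other value is negligible, simultaneously over the
    finite index set. *)
Lemma bernoulli_ae : {ae P, forall w, forall i, X i w = 0 \/ X i w = 1}.
Proof.
apply: filter_forall => i; pose A := X i @^-1` [set 0] `|` X i @^-1` [set 1].
have mA : measurable A by apply: measurableU; apply: mX; exact: measurable_set1.
have PA : P A = 1%E.
  transitivity ((1 - p)%:E + p%:E)%E; last by rewrite -EFinD subrK.
  rewrite -(X0 i) -(X1 i); apply: measureU; try by apply: mX; exact: measurable_set1.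
  by apply/seteqP; split => // w [/= -> /eqP]; rewrite eq_sym oner_eq0.
exists (~` A); split; first exact: measurableC.
  by rewrite probability_setC // PA subee.
by apply: subsetC.
Qed.

(** Almost surely the variable is a finite combination of indicators of the events [E x], whose
    probabilities are products by independence. Expectations thus become finite sums. *)
Lemma expectation_bernoulli (F : (I -> R) -> R) :
  measurable_fun setT (fun w => F (fun i => X i w)) ->
  ('E_P[fun w => F (fun i => X i w)])%E =
  (\sum_(x : {ffun I -> bool}) (\prod_i bern (x i)) * F (fun i => (x i)%:R))%:E.
Proof.
move=> mF; rewrite unlock.
pose E (x : {ffun I -> bool}) := \bigcap_(i in [set` [set: I]%SET]) X i @^-1` [set (x i)%:R].
have mE x : measurable (E x).
  apply: fin_bigcap_measurable => [|i _]; first exact: finite_finset.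
  by apply: mX; exact: measurable_set1.
have PE x : P (E x) = (\prod_i bern (x i))%:E.
  rewrite (X_indep [set: I]%SET (B := fun i => [set (x i)%:R])); last first.
    by move=> i; exact: measurable_set1.
  rewrite -prodEFin; apply: eq_big => [i|i _]; first by rewrite inE.
  by case: (x i).
have Ew w x : (w \in E x) = [forall i, X i w == (x i)%:R].
  apply/idP/forallP => [|h]; first by rewrite inE => h i; apply/eqP; apply: (h i); rewrite /= inE.
  by rewrite inE => i _; apply/eqP.
pose G (x : {ffun I -> bool}) w := ((F (fun i => (x i)%:R))%:E * (\1_(E x) w)%:E)%E.
have iG x : P.-integrable setT (G x).
  by apply: integrableZl => //; exact: integrable_indic.
rewrite (ae_eq_integral (fun w => \sum_x G x w)%E) //; first last.
- apply: filterS bernoulli_ae => w wX _.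
  (* The point [w] belongs to the single event [E x], so all other terms vanish. *)
  pose x := [ffun i => X i w == 1].
  have xE : (fun i => X i w) = (fun i => (x i)%:R).
    apply/funext => i; rewrite ffunE; case: (wX i) => ->; rewrite ?eqxx //.
    by rewrite eq_sym oner_eq0.
  rewrite (bigD1 x) //= big1 ?adde0 => [|y yx].
    rewrite /G indicE Ew (_ : [forall _, _]) ?mule1 -?xE //.
    by apply/forallP => i; rewrite -(congr1 (@^~ i) xE).
  rewrite /G indicE Ew; case: forallP => [h|]; rewrite ?mule0 //.
  case/eqP: yx; apply/ffunP => i; have := h i.
  rewrite (congr1 (@^~ i) xE); by case: (x i); case: (y i) => //; rewrite ?oner_eq0 // eq_sym oner_eq0.
- by apply: emeasurable_sum => x; exact: measurable_int (iG x).
- exact/measurable_EFinP.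
rewrite integral_sum // -sumEFin; apply: eq_bigr => x _.
rewrite /G integralZl //; last exact: integrable_indic.
by rewrite integral_indic // setIT mulrC EFinM; congr (_ * _)%E; exact: PE.
Qed.

Lemma sum_bernoulli_prod (f : I -> bool -> R) :
  \sum_(x : {ffun I -> bool}) (\prod_i bern (x i)) * \prod_i f i (x i) =
  \prod_i (p * f i true + (1 - p) * f i false).
Proof.
transitivity (\sum_(x : {ffun I -> bool}) \prod_i (bern (x i) * f i (x i))).
  by apply: eq_bigr => x _; rewrite big_split.
by rewrite -(bigA_distr_bigA (fun i b => bern b * f i b)); under eq_bigr do rewrite big_bool.
Qed.

Lemma sum_bernoulli : \sum_(x : {ffun I -> bool}) (\prod_i bern (x i)) = 1.
Proof.
transitivity (\sum_(x : {ffun I -> bool}) (\prod_i bern (x i)) * \prod_(i : I) 1).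
  by apply: eq_bigr => x _; rewrite big1_eq mulr1.
by rewrite (sum_bernoulli_prod (fun _ _ => 1)) big1 // => i _; rewrite !mulr1 addrC subrK.
Qed.

Lemma variance_bernoulli (F : (I -> R) -> R) :
  let Z w := F (fun i => X i w) in measurable_fun setT Z ->
  fine ('V_P[Z]) = fine ('E_P[fun w => Z w ^+ 2]) - fine ('E_P[Z]) ^+ 2.
Proof.
move=> Z mZ; set m := fine ('E_P[Z]).
rewrite /variance unlock.
have -> : ((Z \- cst (fine ('E_P[Z]))) * (Z \- cst (fine ('E_P[Z]))))%R =
    (fun w => (F (fun i => X i w) - m) ^+ 2) :> (T -> R).
  by apply/funext => w; rewrite expr2.
rewrite (expectation_bernoulli (F := fun e => (F e - m) ^+ 2)); last first.
  by apply: measurable_funX; apply: measurable_funB.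
rewrite (expectation_bernoulli (F := fun e => F e ^+ 2)); last exact: measurable_funX.
have mE : m = \sum_(x : {ffun I -> bool}) (\prod_i bern (x i)) * F (fun i => (x i)%:R).
  by rewrite /m /Z expectation_bernoulli.
rewrite /=; transitivity (\sum_(x : {ffun I -> bool})
    ((\prod_i bern (x i)) * F (fun i => (x i)%:R) ^+ 2 -
     2 * m * ((\prod_i bern (x i)) * F (fun i => (x i)%:R)) +
     m ^+ 2 * \prod_i bern (x i))).
  by apply: eq_bigr => x _; ring.
rewrite big_split /= sumrB -!mulr_sumr -mE sum_bernoulli; ring.
Qed.

End bernoulli.

(** * Log-moment-generating function of a Bernoulli variable *)

Section bernoulli_mgf.
Variable R : realType.
Implicit Types p x y : R.

Definition bernoulli_mgf p y : R := p * expR y + (1 - p).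
Local Notation mgf := bernoulli_mgf.

Definition log_mgf_even p x := (ln (mgf p x) + ln (mgf p (- x))) / 2.
Definition log_mgf_odd p x := (ln (mgf p x) - ln (mgf p (- x))) / 2.

Lemma bernoulli_mgf_gt0 p y : 0 < p <= 1 -> 0 < mgf p y.
Proof.
move=> /andP[p0 p1]; apply: ltr_wpDr; first by rewrite subr_ge0.
by rewrite mulr_gt0 ?expR_gt0.
Qed.

Lemma bernoulli_mgf0 p : mgf p 0 = 1.
Proof. by rewrite /mgf expR0 mulr1 addrC subrK. Qed.

(** A function of a sign is affine in it, with the even part as constant term and the odd part as
    slope. *)
Lemma bernoulli_mgfE p x a : 0 < p <= 1 -> a = 1 \/ a = -1 ->
  mgf p (x * a) = expR (log_mgf_even p x + log_mgf_odd p x * a).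
Proof.
move=> p01 [->|->]; rewrite ?mulrN ?mulr1 /log_mgf_even /log_mgf_odd.
  rewrite [X in expR X](_ : _ = ln (mgf p x)); last by field.
  by rewrite lnK // posrE bernoulli_mgf_gt0.
rewrite [X in expR X](_ : _ = ln (mgf p (- x))); last by field.
by rewrite lnK // posrE bernoulli_mgf_gt0.
Qed.

(** The sum [a + b] is 0 or twice a sign. The factor [1 + a b] switches the even part off in the
    first case, so only the argument [2 x] enters. *)
Lemma bernoulli_mgf2E p x a b : 0 < p <= 1 ->
  a = 1 \/ a = -1 -> b = 1 \/ b = -1 ->
  mgf p (x * (a + b)) =
  expR (log_mgf_even p (2 * x) / 2 * (1 + a * b) + log_mgf_odd p (2 * x) / 2 * (a + b)).
Proof.
move=> p01 a1 [->|->]; case: a1 => ->.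
- rewrite (_ : x * (1 + 1) = 2 * x * 1); last by ring.
  by rewrite bernoulli_mgfE //; [congr expR; field|left].
- rewrite (_ : -1 + 1 = 0); last by ring.
  by rewrite mulr0 bernoulli_mgf0 mulN1r subrr !mulr0 addr0 expR0.
- rewrite (_ : 1 + -1 = 0); last by ring.
  by rewrite mulr0 bernoulli_mgf0 mulrN1 subrr !mulr0 addr0 expR0.
- rewrite (_ : x * (-1 + -1) = 2 * x * -1); last by ring.
  by rewrite bernoulli_mgfE //; [congr expR; field|right].
Qed.

Lemma expR_le_inv1B x : x < 1 -> expR x <= (1 - x)^-1.
Proof.
move=> x1; rewrite -[x in expR x]opprK expRN lef_pV2 ?posrE ?expR_gt0 ?subr_gt0 //.
exact: expR_ge1Dx.
Qed.

Lemma ln_le_sub1 y : 0 < y -> ln y <= y - 1.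
Proof. by move=> y0; rewrite -[y in ln y](addrNK 1) addrC; apply: le_ln1Dx; lra. Qed.

Lemma ln_ge_1subV y : 0 < y -> 1 - y^-1 <= ln y.
Proof.
move=> y0; have := @ln_le_sub1 y^-1; rewrite invr_gt0 lnV ?posrE // => /(_ y0); lra.
Qed.

(** The bounds [1 / (1 - x)] and [1 / (1 + x)] on the two exponentials add up to [2 / (1 - x^2)]. *)
Lemma cosh_sub1_le x : 0 <= x <= 1 / 2 -> expR x + expR (- x) <= 2 + 4 * x ^+ 2.
Proof.
move=> /andP[x0 x1].
have h1 := @expR_le_inv1B x; have h2 := @expR_le_inv1B (- x).
apply: le_trans (lerD (h1 _) (h2 _)) _; [lra|lra|].
rewrite (_ : _ + _ = 2 / (1 - x ^+ 2)); last by field; apply/and3P; split; rewrite gt_eqF //; nra.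
have y0 : 0 <= x ^+ 2 by exact: sqr_ge0.
have y1 : x ^+ 2 <= 1 / 4 by nra.
rewrite ler_pdivrMr; [nra|lra].
Qed.

Lemma cosh_ge1 x : 2 <= expR x + expR (- x).
Proof. by have := expR_ge1Dx x; have := expR_ge1Dx (- x); lra. Qed.

(* With [C = cosh x - 1] one has [cosh (2 x) - 1 = 4 C + 2 C ^ 2]. *)
Lemma bernoulli_mgfM p x :
  mgf p x * mgf p (- x) = 1 + 2 * p * (1 - p) * ((expR x + expR (- x)) / 2 - 1).
Proof. by rewrite /mgf expRN; field; rewrite gt_eqF ?expR_gt0. Qed.

Lemma bernoulli_mgfM2 p x (C := (expR x + expR (- x)) / 2 - 1) :
  mgf p (2 * x) * mgf p (- (2 * x)) = 1 + 2 * p * (1 - p) * (4 * C + 2 * C ^+ 2).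
Proof.
rewrite bernoulli_mgfM /C -mulrN !expRM_natl expRN; field.
by rewrite gt_eqF ?expR_gt0.
Qed.

Lemma log_mgf_evenE p x : 0 < p <= 1 ->
  log_mgf_even p x = ln (mgf p x * mgf p (- x)) / 2.
Proof. by move=> p01; rewrite lnM ?posrE ?bernoulli_mgf_gt0. Qed.

(** With [q = 2 p (1 - p)], the left side is a quarter of [ln (1 + q (4 C + 2 C^2)) - 4 ln (1 + q
    C)]. The terms linear in [C] cancel, and [C <= 2 x^2] makes the rest of fourth order in [x]. *)
Lemma log_mgf_even_double_le p x : 0 < p <= 1 -> 0 <= x <= 1 / 2 ->
  log_mgf_even p (2 * x) / 2 - 2 * log_mgf_even p x <= 4 * p * x ^+ 4.
Proof.
move=> p01 x01; have /andP[p0 p1] := p01.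
rewrite (log_mgf_evenE (2 * x) p01) (log_mgf_evenE x p01) bernoulli_mgfM2 bernoulli_mgfM.
have C0 := cosh_ge1 x; have C1 := cosh_sub1_le x01.
set C := _ / 2 - 1.
have {}C0 : 0 <= C by rewrite /C; lra.
have {}C1 : C <= 2 * x ^+ 2 by rewrite /C; lra.
set q := 2 * p * (1 - p).
have q0 : 0 <= q by rewrite /q; nra.
have qC : 0 <= q * C by rewrite mulr_ge0.
have qCC : 0 <= q * C ^+ 2 by rewrite mulr_ge0 ?sqr_ge0.
(* Bernoulli's inequality [1 + 4 q C <= (1 + q C)^4], multiplied by [1 + 2 q C^2]. *)
have h : 1 + q * (4 * C + 2 * C ^+ 2) <= (1 + q * C) ^+ 4 * (1 + 2 * q * C ^+ 2).
  have : 1 + 4 * (q * C) <= (1 + q * C) ^+ 4.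
    have := @sqr_ge0 _ (q * C); nra.
  move=> /(ler_wpM2r (_ : 0 <= 1 + 2 * q * C ^+ 2)) => /(_ ltac:(lra)).
  apply: le_trans; nra.
have a0 : 0 < 1 + q * C by lra.
have l : ln (1 + q * (4 * C + 2 * C ^+ 2)) <= 4 * ln (1 + q * C) + 2 * q * C ^+ 2.
  apply: (@le_trans _ _ (ln ((1 + q * C) ^+ 4 * (1 + 2 * q * C ^+ 2)))).
    rewrite ler_ln ?posrE // ?mulr_gt0 ?exprn_gt0 //; lra.
  rewrite lnM ?posrE ?exprn_gt0 //; last by lra.
  rewrite lnXn // -[_ *+ 4]mulr_natl lerD2l; apply: le_ln1Dx; lra.
have CC : C ^+ 2 <= (2 * x ^+ 2) ^+ 2 by rewrite lerXn2r ?nnegrE // mulr_ge0 ?sqr_ge0.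
have : q * C ^+ 2 <= 2 * p * (2 * x ^+ 2) ^+ 2.
  by apply: ler_pM => //; [exact: sqr_ge0|rewrite /q; nra].
lra.
Qed.

Lemma log_mgf_even_le p x : 0 < p <= 1 -> 0 <= x <= 1 / 2 ->
  log_mgf_even p (2 * x) <= 12 * p * x ^+ 2.
Proof.
move=> p01 x01; have /andP[p0 p1] := p01; have /andP[x0 x1] := x01.
rewrite (log_mgf_evenE (2 * x) p01) bernoulli_mgfM2.
have C0 := cosh_ge1 x; have C1 := cosh_sub1_le x01.
set C := _ / 2 - 1.
have {}C0 : 0 <= C by rewrite /C; lra.
have {}C1 : C <= 2 * x ^+ 2 by rewrite /C; lra.
have C2 : C <= 1 by nra.
set q := 2 * p * (1 - p).
have q0 : 0 <= q by rewrite /q; nra.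
have q1 : q <= 2 * p by rewrite /q; nra.
have D0 : 0 <= 4 * C + 2 * C ^+ 2 by rewrite addr_ge0 ?mulr_ge0 ?sqr_ge0.
have D1 : 4 * C + 2 * C ^+ 2 <= 12 * x ^+ 2 by nra.
have : ln (1 + q * (4 * C + 2 * C ^+ 2)) <= q * (4 * C + 2 * C ^+ 2).
  by apply: le_ln1Dx; have := mulr_ge0 q0 D0; lra.
have := ler_pM q0 D0 q1 D1; lra.
Qed.

(** By [1 - 1 / y <= ln y <= y - 1], both [ln (mgf p x)] and [- ln (mgf p (- x))] are at least
    [p x (1 - x)]. The factor [p] in the error matters: for [x = beta / (2 N p)], [p x^2 N] is of
    order [1 / (N p)]. *)
Lemma log_mgf_odd_ge p x : 0 < p <= 1 -> 0 <= x <= 1 / 2 ->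
  p * x - p * x ^+ 2 <= log_mgf_odd p x.
Proof.
move=> p01 /andP[x0 x1]; have /andP[p0 p1] := p01; rewrite /log_mgf_odd.
have e1 := expR_ge1Dx x.
have e2 : expR x <= (1 - x)^-1 by apply: expR_le_inv1B; lra.
have e3 : expR (- x) <= (1 + x)^-1 by rewrite -[X in 1 + X]opprK; apply: expR_le_inv1B; lra.
have m0 := bernoulli_mgf_gt0 x p01; have m0' := bernoulli_mgf_gt0 (- x) p01.
have l1 := ln_ge_1subV m0; have l2 := ln_le_sub1 m0'.
have h1 : p * x * (1 - x) <= 1 - (mgf p x)^-1.
  have x1' : 0 < 1 - x by lra.
  have mV : 1 - x <= (mgf p x)^-1.
    rewrite -[1 - x]invrK lef_pV2 ?posrE ?invr_gt0 //.
    apply: le_trans e2; rewrite /mgf; nra.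
  (* This form exhibits the factor [p]. *)
  rewrite (_ : 1 - (mgf p x)^-1 = p * (expR x - 1) * (mgf p x)^-1); last first.
    by rewrite /mgf; field; rewrite gt_eqF.
  by apply: ler_pM => //; [nra|lra|nra].
have h2 : p * x * (1 - x) <= 1 - mgf p (- x).
  have : (1 + x)^-1 <= 1 - x * (1 - x).
    by rewrite -[leLHS]div1r ler_pdivrMr; nra.
  rewrite /mgf; nra.
lra.
Qed.

Lemma log_mgf_odd_le p x : 0 < p <= 1 -> 0 <= x <= 1 / 4 ->
  log_mgf_odd p (2 * x) / 2 <= p * x + 4 * p * x ^+ 2.
Proof.
move=> p01 /andP[x0 x1]; have /andP[p0 p1] := p01; rewrite /log_mgf_odd.
have x1' : 0 < 1 - 2 * x by lra.
have e1 := expR_ge1Dx (- (2 * x)).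
have e2 : expR (2 * x) <= (1 - 2 * x)^-1 by apply: expR_le_inv1B; lra.
have e4 : expR (- (2 * x)) <= 1 by rewrite expR_le1; lra.
have e3 : (1 - 2 * x)^-1 <= 1 + 2 * x + 8 * x ^+ 2.
  by rewrite -[leLHS]div1r ler_pdivrMr //; nra.
have m0 := bernoulli_mgf_gt0 (2 * x) p01; have m0' := bernoulli_mgf_gt0 (- (2 * x)) p01.
have l1 := ln_le_sub1 m0; have l2 := ln_ge_1subV m0'.
have h1 : mgf p (2 * x) - 1 <= p * (2 * x + 8 * x ^+ 2) by rewrite /mgf; nra.
have h2 : (mgf p (- (2 * x)))^-1 - 1 <= p * (2 * x + 8 * x ^+ 2).
  rewrite (_ : (mgf p (- (2 * x)))^-1 - 1 = p * (1 - expR (- (2 * x))) * (mgf p (- (2 * x)))^-1); last first.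
    by rewrite /mgf; field; rewrite gt_eqF.
  have mV : (mgf p (- (2 * x)))^-1 <= 1 + 4 * x.
    apply: (@le_trans _ _ (1 - 2 * x)^-1).
      by rewrite lef_pV2 ?posrE // /mgf; nra.
    by rewrite -[leLHS]div1r ler_pdivrMr //; nra.
  apply: (@le_trans _ _ (p * (2 * x) * (1 + 4 * x))); last by nra.
  apply: ler_pM => //; [|by rewrite invr_ge0 ltW|].
    by rewrite mulr_ge0 ?(ltW p0) // subr_ge0.
  by rewrite ler_pM2l //; lra.
lra.
Qed.

End bernoulli_mgf.

(** * Moments of the partition function *)

Lemma gibbs_weight_prod (R : realType) (N : nat) (p beta : R) (e : 'I_N * 'I_N -> R)
    (s : config N) :
  expR (- beta * hamiltonian p e s) =
  \prod_(ij : 'I_N * 'I_N)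
    expR (beta / (2 * N%:R * p) * e ij * (spin R s ij.1 * spin R s ij.2)).
Proof.
rewrite -expR_sum /hamiltonian mulrA mulrNN pair_big /= mulr_sumr.
by congr expR; apply: eq_bigr => -[i j] _ /=; ring.
Qed.

Lemma measurable_partition_function (R : realType) (d : measure_display)
    (T : measurableType d) (P : probability T R) (N : nat)
    (X : 'I_N * 'I_N -> {RV P >-> R}) (p beta : R) (g : R -> R) :
  measurable_fun setT (fun w => partition_function p beta g (fun ij => X ij w)).
Proof.
apply: measurable_sum => s; apply: measurable_funM; last exact: measurable_cst.
apply: measurableT_comp => //; apply: measurable_funM => //.
apply: measurable_funM => //.
apply: measurable_sum => i; apply: measurable_sum => j.
by apply: measurable_funM => //; apply: measurable_funM.
Qed.

Section moments.
Variables (R : realType) (d : measure_display) (T : measurableType d).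
Variables (P : probability T R) (N : nat) (X : 'I_N * 'I_N -> {RV P >-> R}).
Variables (p beta : R) (g : R -> R).
Hypothesis X_indep : mutually_independent X.
Hypothesis X1 : forall i, P (X i @^-1` [set 1]) = p%:E.
Hypothesis X0 : forall i, P (X i @^-1` [set 0]) = (1 - p)%:E.

Let Z w := partition_function p beta g (fun ij => X ij w).
Let gN (s : config N) := g (mag R s / Num.sqrt N%:R).
Let x := beta / (2 * N%:R * p).
Local Notation mgf := (bernoulli_mgf p).

Lemma expectation_partition :
  fine ('E_P[Z]) =
  \sum_(s : config N) gN s * \prod_(ij : 'I_N * 'I_N) mgf (x * (spin R s ij.1 * spin R s ij.2)).
Proof.
rewrite (expectation_bernoulli X_indep X1 X0 (F := partition_function p beta g)); last first.
  exact: measurable_partition_function.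
rewrite /= /partition_function.
under eq_bigr do rewrite mulr_sumr.
rewrite exchange_big /=; apply: eq_bigr => s _.
pose f (ij : 'I_N * 'I_N) (b : bool) := expR (x * b%:R * (spin R s ij.1 * spin R s ij.2)).
transitivity (gN s * \sum_(y : {ffun 'I_N * 'I_N -> bool})
   (\prod_ij (if y ij then p else 1 - p)) *
   \prod_(ij : 'I_N * 'I_N) f ij (y ij)).
  by rewrite mulr_sumr; apply: eq_bigr => y _; rewrite gibbs_weight_prod mulrA mulrC.
rewrite sum_bernoulli_prod; congr (_ * _); apply: eq_bigr => ij _.
by rewrite /f mulr1 mulr0 mul0r expR0 mulr1.
Qed.

(** Both replicas see the same edges, so each edge contributes one generating function evaluated at
    the sum of the two spin products. *)
Lemma expectation_partition_sqr :
  fine ('E_P[fun w => Z w ^+ 2]) =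
  \sum_(s : config N) \sum_(t : config N) gN s * gN t *
    \prod_(ij : 'I_N * 'I_N)
       mgf (x * (spin R s ij.1 * spin R s ij.2 + spin R t ij.1 * spin R t ij.2)).
Proof.
rewrite (expectation_bernoulli X_indep X1 X0
  (F := fun e => partition_function p beta g e ^+ 2)); last first.
  by apply: measurable_funX; exact: measurable_partition_function.
rewrite /=.
pose f s t (ij : 'I_N * 'I_N) (b : bool) := expR (x * b%:R *
  (spin R s ij.1 * spin R s ij.2 + spin R t ij.1 * spin R t ij.2)).
transitivity (\sum_(y : {ffun 'I_N * 'I_N -> bool}) \sum_(s : config N) \sum_(t : config N)
   gN s * gN t * ((\prod_ij (if y ij then p else 1 - p)) *
   \prod_(ij : 'I_N * 'I_N) f s t ij (y ij))).
  apply: eq_bigr => y _; rewrite expr2 /partition_function big_distrlr /= mulr_sumr.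
  apply: eq_bigr => s _; rewrite mulr_sumr; apply: eq_bigr => t _.
  rewrite !gibbs_weight_prod /gN /mag /f.
  under [X in _ = _ * (_ * X)]eq_bigr do rewrite mulrDr expRD.
  by rewrite big_split /= -/x; ring.
rewrite exchange_big; apply: eq_bigr => s _; rewrite exchange_big; apply: eq_bigr => t _.
rewrite -mulr_sumr sum_bernoulli_prod; congr (_ * _); apply: eq_bigr => ij _.
by rewrite /f mulr1 mulr0 mul0r expR0 mulr1.
Qed.

End moments.

Lemma sum_spin2 (R : realType) (N : nat) (f : 'I_N -> R) :
  \sum_(ij : 'I_N * 'I_N) f ij.1 * f ij.2 = (\sum_(i < N) f i) ^+ 2.
Proof. by rewrite expr2 big_distrlr /= pair_big. Qed.

Lemma prod_expR_spin (R : realType) (N : nat) (u v : R) (s : config N) :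
  \prod_(ij : 'I_N * 'I_N) expR (u + v * (spin R s ij.1 * spin R s ij.2)) =
  expR (u * N%:R ^+ 2 + v * mag R s ^+ 2).
Proof.
rewrite -expR_sum big_split /= -mulr_sumr sum_spin2 sumr_const card_prod card_ord.
by rewrite -[_ *+ _]mulr_natr natrM.
Qed.

Lemma prod_expR_spin2 (R : realType) (N : nat) (u v : R) (s t : config N) :
  \prod_(ij : 'I_N * 'I_N)
    expR (u * (1 + (spin R s ij.1 * spin R s ij.2) * (spin R t ij.1 * spin R t ij.2)) +
          v * (spin R s ij.1 * spin R s ij.2 + spin R t ij.1 * spin R t ij.2)) =
  expR (u * (N%:R ^+ 2 + (\sum_(i < N) spin R s i * spin R t i) ^+ 2) +
        v * (mag R s ^+ 2 + mag R t ^+ 2)).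
Proof.
have QE : \sum_(ij : 'I_N * 'I_N)
    spin R s ij.1 * spin R s ij.2 * (spin R t ij.1 * spin R t ij.2) =
    (\sum_(i < N) spin R s i * spin R t i) ^+ 2.
  by rewrite -sum_spin2; apply: eq_bigr => ij _; rewrite mulrACA.
rewrite -expR_sum big_split /= -!mulr_sumr !big_split /= !sum_spin2 sumr_const card_prod.
by rewrite card_ord natrM -expr2 QE.
Qed.

Lemma spinM (R : realType) (N : nat) (s : config N) (i j : 'I_N) :
  spin R s i * spin R s j = 1 \/ spin R s i * spin R s j = -1.
Proof.
by rewrite /spin -signr_addb; case: (_ (+) _); rewrite ?expr1 ?expr0; [right|left].
Qed.

Section moments_log.
Variables (R : realType) (d : measure_display) (T : measurableType d).
Variables (P : probability T R) (N : nat) (X : 'I_N * 'I_N -> {RV P >-> R}).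
Variables (p beta : R) (g : R -> R).
Hypothesis p01 : 0 < p <= 1.
Hypothesis X_indep : mutually_independent X.
Hypothesis X1 : forall i, P (X i @^-1` [set 1]) = p%:E.
Hypothesis X0 : forall i, P (X i @^-1` [set 0]) = (1 - p)%:E.

Let Z w := partition_function p beta g (fun ij => X ij w).
Let gN (s : config N) := g (mag R s / Num.sqrt N%:R).
Let x := beta / (2 * N%:R * p).
Let u := log_mgf_even p x.
Let v := log_mgf_odd p x.
Let U := log_mgf_even p (2 * x).
Let V := log_mgf_odd p (2 * x).

Lemma expectation_partition_log :
  fine ('E_P[Z]) = expR (u * N%:R ^+ 2) * \sum_(s : config N) gN s * expR (v * mag R s ^+ 2).
Proof.
rewrite (expectation_partition beta g X_indep X1 X0) mulr_sumr; apply: eq_bigr => s _.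
rewrite mulrCA -expRD -prod_expR_spin; congr (_ * _); apply: eq_bigr => ij _.
by rewrite (bernoulli_mgfE _ p01 (spinM _ _ _ _)).
Qed.

Lemma expectation_partition_sqr_log :
  fine ('E_P[fun w => Z w ^+ 2]) =
  \sum_(s : config N) \sum_(t : config N) gN s * gN t *
    expR (U / 2 * (N%:R ^+ 2 + (\sum_(i < N) spin R s i * spin R t i) ^+ 2) +
          V / 2 * (mag R s ^+ 2 + mag R t ^+ 2)).
Proof.
rewrite (expectation_partition_sqr beta g X_indep X1 X0); apply: eq_bigr => s _.
apply: eq_bigr => t _.
rewrite -prod_expR_spin2; congr (_ * _); apply: eq_bigr => ij _.
by rewrite (bernoulli_mgf2E _ p01 (spinM _ _ _ _) (spinM _ _ _ _)).
Qed.

(** A bound at fixed [N]: [w] is the small error from the logarithmic expansions and [theta] a fixed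
    margin. The factor multiplying [w] is free of [N]. *)
Lemma variance_ratio_le (G A w theta c t K : R) :
  K = 2 * expR (1 / 2) / (1 - expR (- c)) ->
  (0 < N)%N -> (forall y, 0 <= g y <= G) -> 0 <= w <= theta -> 0 < theta ->
  (U / 2 - 2 * u) * N%:R ^+ 2 <= w ->
  U / 2 * N%:R <= w ->
  V / 2 * N%:R <= v * N%:R + w ->
  0 <= v * N%:R <= beta / 2 + theta ->
  0 < c -> 0 < t ->
  (1 + t) * (beta / 2 + 3 * theta) <= 1 / 2 - c ->
  (1 + t^-1) * (2 * theta) <= 1 / 2 - c ->
  0 < A -> A * 2 ^+ N <= \sum_(s : config N) gN s ->
  0 <= fine ('V_P[Z]) / fine ('E_P[Z]) ^+ 2 <=
  w * (G ^+ 2 * expR (2 * theta) * (K ^+ 2 + K) / (theta * A ^+ 2)).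
Proof.
move=> KE N0 gG /andP[w0 wt] th0 hU1 hU2 hV /andP[v0 v1] c0 t0 hb ha A0 hA.
have mZ : measurable_fun setT Z by exact: measurable_partition_function.
have G0 : 0 <= G by case/andP: (gG 0) => /le_trans h /h.
have NR : 0 < N%:R :> R by rewrite ltr0n.
have gN0 s : 0 <= gN s by case/andP: (gG (mag R s / Num.sqrt N%:R)).
have gNG s : gN s <= G by case/andP: (gG (mag R s / Num.sqrt N%:R)).
set A' := \sum_(s : config N) gN s * expR (v * mag R s ^+ 2).
have v0' : 0 <= v by rewrite -(pmulr_lge0 _ NR).
have A'A : A * 2 ^+ N <= A'.
  apply: le_trans hA _; apply: ler_sum => s _; rewrite ler_peMr //.
  by rewrite -[leLHS]expR0 ler_expR mulr_ge0 ?sqr_ge0.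
have A2 : 0 < A * 2 ^+ N by rewrite mulr_gt0 ?exprn_gt0.
have A'0 : 0 < A' by apply: lt_le_trans A'A.
pose Y (s : config N) : R := mag R s ^+ 2 / N%:R.
pose Q (s s' : config N) : R := (\sum_(i < N) spin R s i * spin R s' i) ^+ 2 / N%:R.
have Y0 s : 0 <= Y s by rewrite /Y divr_ge0 ?sqr_ge0.
have Q0 s s' : 0 <= Q s s' by rewrite /Q divr_ge0 ?sqr_ge0.
have YE s : mag R s ^+ 2 = N%:R * Y s by rewrite /Y mulrC divfK ?gt_eqF.
have QE s s' : (\sum_(i < N) spin R s i * spin R s' i) ^+ 2 = N%:R * Q s s'.
  by rewrite /Q mulrC divfK ?gt_eqF.
have K0 : 0 <= K by rewrite KE divr_ge0 ?mulr_ge0 ?expR_ge0 // subr_ge0 expR_le1 oppr_le0 ltW.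
apply/andP; split; first by rewrite divr_ge0 ?sqr_ge0 // fine_ge0 // variance_ge0.
(* The common factor [e^(2 u N^2)] cancels, leaving the difference of two exponentials for each
   pair. *)
have -> : fine ('V_P[Z]) / fine ('E_P[Z]) ^+ 2 =
  (\sum_(s : config N) \sum_(s' : config N) gN s * gN s' *
    (expR ((U / 2 - 2 * u) * N%:R ^+ 2 + U / 2 * N%:R * Q s s' + V / 2 * N%:R * (Y s + Y s'))
     - expR (v * N%:R * (Y s + Y s')))) / A' ^+ 2.
  rewrite (variance_bernoulli X_indep X1 X0 mZ).
  rewrite expectation_partition_log expectation_partition_sqr_log -/A'.
  rewrite exprMn -expRM_natl.
  have -> : \sum_(s : config N) \sum_(s' : config N) gN s * gN s' *
    expR (U / 2 * (N%:R ^+ 2 + (\sum_(i < N) spin R s i * spin R s' i) ^+ 2) +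
          V / 2 * (mag R s ^+ 2 + mag R s' ^+ 2)) =
    expR (2 * (u * N%:R ^+ 2)) * \sum_(s : config N) \sum_(s' : config N) gN s * gN s' *
    expR ((U / 2 - 2 * u) * N%:R ^+ 2 + U / 2 * N%:R * Q s s' + V / 2 * N%:R * (Y s + Y s')).
    rewrite mulr_sumr; apply: eq_bigr => s _; rewrite mulr_sumr; apply: eq_bigr => s' _.
    rewrite mulrCA -expRD; congr (_ * expR _); rewrite !YE QE; ring.
  rewrite -mulrBr -mulf_div divff ?mul1r ?gt_eqF ?expR_gt0 //; congr (_ / _).
  rewrite [X in _ - X]expr2 {1 2}/A' big_distrlr /= -sumrB; apply: eq_bigr => s _.
  rewrite -sumrB; apply: eq_bigr => s' _; rewrite mulrBr; congr (_ - _).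
  rewrite mulrACA -expRD; congr (_ * expR _); rewrite !YE; ring.
rewrite ler_pdivrMr ?exprn_gt0 //.
pose B s s' := 2 * theta * Q s s' + (beta / 2 + 3 * theta) * (Y s + Y s').
have HB s s' :
    expR ((U / 2 - 2 * u) * N%:R ^+ 2 + U / 2 * N%:R * Q s s' + V / 2 * N%:R * (Y s + Y s'))
     - expR (v * N%:R * (Y s + Y s')) <= w / theta * expR (2 * theta) * expR (B s s').
  have := Q0 s s'; have : 0 <= Y s + Y s' by rewrite addr_ge0.
  rewrite /B; move: (Q s s') (Y s + Y s') => q y y0 q0 {B}.
  set a := _ + _ * y; set b := v * _ * y; set W := 1 + q + y.
  have ab : a <= b + w * W.
    have h1 := ler_wpM2r q0 hU2; have h2 := ler_wpM2r y0 hV.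
    rewrite /a /b /W; lra.
  have W0 : 0 <= W by rewrite /W; lra.
  have h1 : expR a - expR b <= w * W * expR (b + w * W).
    apply: (@le_trans _ _ (expR (b + w * W) - expR b)); first by rewrite lerD2r ler_expR.
    have := expR_ge1Dx (- (w * W)).
    move=> /(ler_wpM2l (expR_ge0 (b + w * W))); rewrite -expRD addrK; lra.
  (* The linear factor [W] is traded for an exponential of rate [theta]. Together with [w <= theta]
     this adds [2 theta W] to the exponent, which explains [e^(2 theta)] and the coefficients in
     [B]. *)
  have h2 : W <= expR (theta * W) / theta.
    rewrite ler_pdivlMr // mulrC; apply: le_trans (expR_ge1Dx _); lra.
  apply: le_trans h1 _.
  have wW : w * W <= theta * W by rewrite ler_wpM2r.
  apply: (@le_trans _ _ (w * (expR (theta * W) / theta) * expR (b + theta * W))).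
    apply: ler_pM; rewrite ?mulr_ge0 ?expR_ge0 //; first by rewrite ler_wpM2l.
    by rewrite ler_expR lerD2l.
  rewrite [leLHS](_ : _ = w / theta * (expR (theta * W) * expR (b + theta * W))); last by ring.
  rewrite -[leRHS]mulrA ler_wpM2l ?divr_ge0 ?(ltW th0) // -!expRD ler_expR.
  have := ler_wpM2r y0 v1; rewrite /b /W; lra.
apply: (@le_trans _ _ (\sum_(s : config N) \sum_(s' : config N)
    G ^+ 2 * (w / theta * expR (2 * theta)) * expR (B s s'))).
  apply: ler_sum => s _; apply: ler_sum => s' _.
  apply: (@le_trans _ _ (gN s * gN s' * (w / theta * expR (2 * theta) * expR (B s s')))).
    by rewrite ler_wpM2l ?mulr_ge0.
  rewrite -[leRHS]mulrA; apply: ler_wpM2r.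
    by rewrite mulr_ge0 ?expR_ge0 // mulr_ge0 ?expR_ge0 // divr_ge0 // ltW.
  by rewrite expr2 ler_pM.
under eq_bigr do rewrite -mulr_sumr.
rewrite -mulr_sumr.
have S := sum_pair_expR_le N0 c0 t0 hb ha KE.
have cG : 0 <= G ^+ 2 * (w / theta * expR (2 * theta)).
  by rewrite mulr_ge0 ?sqr_ge0 // mulr_ge0 ?expR_ge0 // divr_ge0 // ltW.
apply: le_trans (ler_wpM2l cG S) _.
have AA : (A * 2 ^+ N) ^+ 2 <= A' ^+ 2.
  by rewrite lerXn2r ?nnegrE ?(ltW A2) ?(ltW A'0).
apply: (@le_trans _ _ (w * (G ^+ 2 * expR (2 * theta) * (K ^+ 2 + K) / (theta * A ^+ 2)) *
   (A * 2 ^+ N) ^+ 2)); last first.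
  have KK : 0 <= K ^+ 2 + K by rewrite addr_ge0 ?sqr_ge0.
  apply: ler_wpM2l => //; apply: mulr_ge0 => //; apply: divr_ge0.
    by apply: mulr_ge0 => //; apply: mulr_ge0; rewrite ?expR_ge0 ?sqr_ge0.
  by apply: mulr_ge0; rewrite ?sqr_ge0 ?(ltW th0).
rewrite le_eqVlt; apply/orP; left; apply/eqP; rewrite exprMn; field.
by rewrite !gt_eqF.
Qed.

End moments_log.

(** * Asymptotics *)

(** Here [p x N = beta / 2], while [p x^2 N] and [p x^4 N^2] are of order [1 / (N p)] and
    [1 / (p^3 N^2)], the two terms of [w]. The bound [w <= 1] keeps [x <= 1 / 4]. *)
Lemma log_mgf_bounds (R : realType) (N : nat) (p beta : R)
    (x := beta / (2 * N%:R * p)) (w := 2 / (N%:R * p) + (p ^+ 3 * N%:R ^+ 2)^-1) :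
  (0 < N)%N -> 0 < p <= 1 -> 0 < beta < 1 -> w <= 1 ->
  [/\ (log_mgf_even p (2 * x) / 2 - 2 * log_mgf_even p x) * N%:R ^+ 2 <= w,
      log_mgf_even p (2 * x) / 2 * N%:R <= w,
      log_mgf_odd p (2 * x) / 2 * N%:R <= log_mgf_odd p x * N%:R + w &
      0 <= log_mgf_odd p x * N%:R <= beta / 2 + w].
Proof.
move=> N0 p01 /andP[b0 b1] w1; have /andP[p0 p1] := p01.
have NR : 0 < N%:R :> R by rewrite ltr0n.
have Np : 0 < N%:R * p by rewrite mulr_gt0.
have q0 : 0 < (p ^+ 3 * N%:R ^+ 2)^-1 by rewrite invr_gt0 mulr_gt0 ?exprn_gt0.
have y0 : 0 < (N%:R * p)^-1 by rewrite invr_gt0.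
have y1 : (N%:R * p)^-1 <= 1 / 2 by rewrite /w in w1; lra.
have xy : x = beta / 2 * (N%:R * p)^-1.
  by rewrite /x; field; rewrite !gt_eqF.
have x0 : 0 < x by rewrite xy mulr_gt0 // divr_gt0.
have x1 : x <= 1 / 4 by rewrite xy; nra.
have px : p * x * N%:R = beta / 2 by rewrite /x; field; rewrite !gt_eqF.
have pxx : 4 * (p * x ^+ 2 * N%:R) <= (N%:R * p)^-1.
  rewrite (_ : p * x ^+ 2 * N%:R = beta ^+ 2 / 4 * (N%:R * p)^-1); last first.
    by rewrite /x; field; rewrite !gt_eqF.
  have : beta ^+ 2 <= 1 by rewrite expr_le1 ?ltW.
  nra.
have px4 : 4 * p * x ^+ 4 * N%:R ^+ 2 <= (p ^+ 3 * N%:R ^+ 2)^-1.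
  rewrite (_ : 4 * p * x ^+ 4 * N%:R ^+ 2 = beta ^+ 4 / 4 * (p ^+ 3 * N%:R ^+ 2)^-1); last first.
    by rewrite /x; field; rewrite !gt_eqF.
  have : beta ^+ 4 <= 1 by rewrite exprn_ile1 ?ltW.
  nra.
have xI : 0 <= x <= 1 / 2 by apply/andP; split; lra.
have xI' : 0 <= x <= 1 / 4 by apply/andP; split; lra.
(* The upper bound on the odd part is stated at a doubled argument, so it is used at [x / 2] to
   control the value at [x]. *)
have xI2 : 0 <= x / 2 <= 1 / 4 by apply/andP; split; lra.
have xE : x = 2 * (x / 2) by field.
have N0' := ltW NR.
have e1 := ler_wpM2r (sqr_ge0 N%:R) (log_mgf_even_double_le p01 xI).
have e2 := ler_wpM2r N0' (log_mgf_even_le p01 xI).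
have e3 := ler_wpM2r N0' (log_mgf_odd_ge p01 xI).
have e4 := ler_wpM2r N0' (log_mgf_odd_le p01 xI').
have e5 := ler_wpM2r N0' (log_mgf_odd_le p01 xI2); rewrite -xE in e5.
rewrite /w; split.
- lra.
- lra.
- lra.
- have : 0 <= p * x * N%:R * (1 - x) by rewrite mulr_ge0 ?px; lra.
  by move=> ?; apply/andP; split; lra.
Qed.

(** Since [p <= 1], [p^3 N^2 <= (N p)^2], so [N p] diverges as well. *)
Lemma sparsity_cvg (R : realType) (p : nat -> R) :
  (forall N, 0 < p N /\ p N <= 1) -> p N ^+ 3 * N%:R ^+ 2 @[N --> \oo] --> +oo ->
  forall e : R, 0 < e ->
  \forall N \near \oo, 2 / (N%:R * p N) + (p N ^+ 3 * N%:R ^+ 2)^-1 <= e.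
Proof.
move=> p01 pN e e0; near=> N.
have [p0 p1] := p01 N.
have N0 : (0 < N)%N by near: N; exact: nbhs_infty_gt.
have NR : 0 < N%:R :> R by rewrite ltr0n.
(* The square forces [N p >= 4 / e], and [2 / e] controls the inverse; each error is then at most
   [e / 2]. *)
have qe : (4 / e) ^+ 2 + 2 / e <= p N ^+ 3 * N%:R ^+ 2.
  by near: N; move/cvgryPge : pN; apply.
have e2 : 0 < 2 / e by rewrite divr_gt0.
have e4 : 0 < 4 / e by rewrite divr_gt0.
have Np : 0 < N%:R * p N by rewrite mulr_gt0.
have q0 : 0 < p N ^+ 3 * N%:R ^+ 2 by rewrite mulr_gt0 ?exprn_gt0.
have h1 : (p N ^+ 3 * N%:R ^+ 2)^-1 <= e / 2.
  rewrite -[e / 2]invrK invf_div lef_pV2 ?posrE //.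
  by have := sqr_ge0 (4 / e); lra.
have h2 : 4 / e <= N%:R * p N.
  rewrite -(@ler_pXn2r _ 2) ?nnegrE ?(ltW Np) ?(ltW e4) //.
  rewrite [leRHS]exprMn [leRHS]mulrC; apply: (@le_trans _ _ (p N ^+ 3 * N%:R ^+ 2)); first lra.
  by rewrite ler_wpM2r ?sqr_ge0 // exprS ler_piMl ?sqr_ge0.
have h3 : (N%:R * p N)^-1 <= e / 4 by rewrite -[e / 4]invrK invf_div lef_pV2 ?posrE.
lra.
Unshelve. all: by end_near. Qed.

(** By continuity [g] exceeds half of a positive value on an interval, to which [mag_window]
    applies. *)
Lemma sum_test_function_ge (R : realType) (g : R -> R) :
  continuous g -> (forall x, 0 <= g x) -> (exists x, g x != 0) ->
  exists A r0 : R, 0 < A /\ forall N : nat, r0 <= Num.sqrt N%:R ->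
  A * 2 ^+ N <= \sum_(s : config N) g (mag R s / Num.sqrt N%:R).
Proof.
move=> g_cont g_ge0 [x0 gx0].
have g0 : 0 < g x0 by rewrite lt_neqAle eq_sym gx0 g_ge0.
have /nbhs_ballP[e /= e0 He] : \forall y \near x0, g x0 / 2 < g y.
  by have := @cvgr_gt _ _ _ _ g (g x0) (g_cont x0) (g x0 / 2); apply; lra.
have [|c [r0 [c0 H]]] := @mag_window R (x0 - e) (x0 + e); first by lra.
exists (g x0 / 2 * c), r0; split; first by rewrite mulr_gt0 // divr_gt0.
move=> N Nr; rewrite -mulrA.
have g2 : 0 <= g x0 / 2 by rewrite divr_ge0.
apply: le_trans (ler_wpM2l g2 (H N Nr)) _.
rewrite mulr_sumr; apply: ler_sum => s _.
case: (boolP (_ < _ < _)%R) => [/andP[h1 h2]|_]; last by rewrite mulr0.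
rewrite mulr1 ltW //; apply: He; rewrite /ball /= ltr_norml; apply/andP; split; lra.
Qed.

Theorem theorem1p6 (R : realType) (p : nat -> R)
    (d : nat -> measure_display) (T : forall N : nat, measurableType (d N))
    (P : forall N : nat, probability (T N) R)
    (eps : forall N : nat, 'I_N * 'I_N -> {RV (P N) >-> R})
    (p01 : forall N : nat, 0 < p N /\ p N <= 1)
    (eps_indep : forall N : nat, mutually_independent (eps N))
    (eps1 : forall (N : nat) (ij : 'I_N * 'I_N),
       P N (eps N ij @^-1` [set 1]) = (p N)%:E)
    (eps0 : forall (N : nat) (ij : 'I_N * 'I_N),
       P N (eps N ij @^-1` [set 0]) = (1 - p N)%:E)
    (beta : R) (beta01 : 0 < beta /\ beta < 1)
    (p_dense : p N ^+ 3 * N%:R ^+ 2 @[N --> \oo] --> +oo)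
    (g : R -> R) (g_cont : continuous g) (g_bounded : bounded_fun g)
    (g_ge0 : forall x : R, 0 <= g x) (g_neq0 : exists x : R, g x != 0) :
  let Z (N : nat) : T N -> R := fun w =>
    partition_function (p N) beta g (fun ij => eps N ij w) in
  fine ('V_(P N)[Z N]) / fine ('E_(P N)[Z N]) ^+ 2 @[N --> \oo] --> (0 : R).
Proof.
move=> Z; have [b0 b1] := beta01.
have [A [r0 [A0 HA]]] := sum_test_function_ge g_cont g_ge0 g_neq0.
have [G gG] : exists G, forall y, 0 <= g y <= G.
  have [M [_ HM]] := g_bounded; exists (M + 1) => y; rewrite g_ge0 /=.
  by apply: le_trans (ler_norm _) _; apply: HM => //; lra.
(* The gap [1 / 2 - beta / 2] pays for both [c] and [t]; [theta] is quadratic in [1 - beta] so that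
   [t^-1 * theta] remains of order [1 - beta]. *)
pose c := (1 - beta) / 8; pose t := (1 - beta) / 4; pose theta := (1 - beta) ^+ 2 / 32.
have c0 : 0 < c by rewrite /c; lra.
have t0 : 0 < t by rewrite /t; lra.
have th0 : 0 < theta by rewrite /theta divr_gt0 ?exprn_gt0 ?subr_gt0.
have th1 : theta <= 1 by rewrite /theta; nra.
have hb : (1 + t) * (beta / 2 + 3 * theta) <= 1 / 2 - c.
  have := mulr_ge0 (sqr_ge0 (1 - beta)) (ltW b0); have := sqr_ge0 (1 - beta).
  by rewrite /t /theta /c; lra.
have ha : (1 + t^-1) * (2 * theta) <= 1 / 2 - c.
  rewrite [leLHS](_ : _ = (1 - beta) ^+ 2 / 16 + (1 - beta) / 4); last first.
    by rewrite /t /theta; field; rewrite subr_eq0 gt_eqF.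
  by rewrite /c; nra.
pose K := 2 * expR (1 / 2) / (1 - expR (- c)).
set C := G ^+ 2 * expR (2 * theta) * (K ^+ 2 + K) / (theta * A ^+ 2).
apply/cvgrPdist_le => e e0.
pose w N := 2 / (N%:R * p N) + (p N ^+ 3 * N%:R ^+ 2)^-1.
near=> N.
have N0 : (0 < N)%N by near: N; exact: nbhs_infty_gt.
have Nr : r0 <= Num.sqrt N%:R.
  (* The threshold [r0] may be negative; [N >= r0^2] suffices in every case. *)
  apply: (@le_trans _ _ (Num.sqrt (r0 ^+ 2))); first by rewrite sqrtr_sqr ler_norm.
  by apply: ler_wsqrtr; near: N; exact: nbhs_infty_ger.
have wth : w N <= theta by near: N; exact: sparsity_cvg.
(* Adding 1 to the absolute value of [C] keeps the divisor positive. *)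
have we : w N <= e / (1 + `|C|).
  by near: N; apply: sparsity_cvg => //; rewrite divr_gt0 // ltr_wpDr.
have p01' : 0 < p N <= 1 by apply/andP; exact: p01.
have w0 : 0 <= w N.
  have /andP[/ltW p0 _] := p01'.
  by rewrite /w addr_ge0 ?divr_ge0 ?invr_ge0 ?mulr_ge0 ?exprn_ge0.
have bI : 0 < beta < 1 by rewrite b0.
have [h1 h2 h3 h4] := log_mgf_bounds N0 p01' bI (le_trans wth th1).
have wI : 0 <= w N <= theta by rewrite w0.
have h4' : 0 <= log_mgf_odd (p N) (beta / (2 * N%:R * p N)) * N%:R <= beta / 2 + theta.
  by case/andP: h4 => -> /le_trans; apply; rewrite lerD2l.
have := variance_ratio_le p01' (eps_indep N) (eps1 N) (eps0 N) (erefl K) N0 gG wI th0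
  h1 h2 h3 h4' c0 t0 hb ha A0 (HA N Nr).
rewrite -/C -/(Z N) => /andP[r1 r2].
rewrite sub0r normrN ger0_norm //; apply: le_trans r2 _.
apply: (@le_trans _ _ (w N * (1 + `|C|))).
  by rewrite ler_wpM2l // ler_wpDl // ler_norm.
by rewrite -ler_pdivlMr // ltr_wpDr.
Unshelve. all: by end_near. Qed.
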